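(* Let $K$ be a compact group with an irreducible unitary representation $\rho$ on a finite-dimensional complex vector space $V$, and let $U, W \leq V$ be subspaces. Then there exists $g \in K$ with $$\dim\bigl(W + \rho(g) \cdot U\bigr) \geq \dim W + \Bigl(1 - \frac{\dim W}{\dim V}\Bigr)\dim U .$$
   Context: All representations are finite-dimensional complex representations; for a compact (topological) group they are continuous and unitary with respect to a Hermitian inner product on $V$. The notation $U \leq V$ means that $U$ is a linear subspace of $V$. *)

(* Defs.v *)
From HB Require Import structures.
From mathcomp Require Import all_boot all_order all_algebra.
From mathcomp Require Import sesquilinear.
From mathcomp Require Import all_classical all_reals all_analysis.
From mathcomp Require Export complex.

Set Implicit Arguments.
Unset Strict Implicit.
Unset Printing Implicit Defensive.

Import Order.TTheory GRing.Theory Num.Theory.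
Export numFieldNormedType.Exports.

Local Open Scope classical_set_scope.
Local Open Scope ring_scope.

(* The topology of R[i] is the one every numFieldType has, given by its norm. *)
HB.instance Definition _ (R : rcfType) := PseudoMetric.copy R[i] R[i]^o.

HB.mixin Record PreTopologicalGroup_isTopologicalGroup G
    & Topological G & Group G := {
  mulg_continuous : continuous (fun x : G * G => (x.1 * x.2)%g) ;
  invg_continuous : continuous (fun x : G => (x^-1)%g)
}.

#[short(type="topologicalGroupType")]
HB.structure Definition TopologicalGroup :=
  {G of Topological G & Group G & PreTopologicalGroup_isTopologicalGroup G}.

Section Representation.
Variables (R : realType) (K : topologicalGroupType) (V : vectType R[i]).
Implicit Types rho : K -> 'End(V).

Definition is_rep rho : Prop :=
  rho 1%g = \1%VF /\ forall g h : K, rho (g * h)%g = (rho g \o rho h)%VF.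

(* V carries its canonical topology as a finite-dimensional complex vector    *)
(* space, so 'End(V) is topologized through the matrix of an endomorphism in  *)
(* a basis; the resulting topology does not depend on the basis.              *)
Definition continuous_rep rho : Prop :=
  continuous (fun g : K => passmx.mxof (vbasis {:V}) (vbasis {:V}) (rho g)).

Definition unitary_rep (form : {dot V for Num.conj}) rho : Prop :=
  forall g : K, isometry form form (rho g).

Definition irreducible_rep rho : Prop :=
  {:V}%VS <> 0%VS /\
  forall U : {vspace V},
    (forall g : K, (rho g @: U <= U)%VS) -> U = 0%VS \/ U = {:V}%VS.

End Representation.

(* Main.v *)
Require Import Defs.
From mathcomp Require Import all_boot all_order all_algebra sesquilinear.
From mathcomp Require Import all_classical all_reals all_analysis complex.
From mathcomp Require Import spectral ring.

(** Let n, p, q be the dimensions of V, W, U. Since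
    dim (W + gU) = p + q - dim (W :&: gU), the claim is that some g satisfies
    n * dim (W :&: gU) <= p * q.

    In an orthonormal basis the operators rho g become unitary matrices. With
    P and Q the orthogonal projections on W and U, the projection on gU is
    Q^g := g^* Q g (row vectors, matrices acting on the right), and
    [rank_cap_le_trace] gives dim (W :&: gU) <= tr (P Q^g). The usual argument
    averages Q^g over Haar measure: by Schur's lemma the mean is the scalar
    matrix q/n, so tr (P Q^g) has mean pq/n and takes a value at most pq/n.

    Haar measure is replaced by the uniqueness of the point of least
    Hilbert-Schmidt norm in the convex hull of the orbit of Q. Let m be the
    infimum of the squared norm over the matrices obtained from that orbit by
    taking midpoints. If A is such a matrix and its squared norm is at most
    m + d^2, then so is that of A^g, and the parallelogram law, applied to A, A^g
    and their midpoint, bounds A - A^g by 2d ([near_minimal_close]): a nearly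
    minimal A is nearly invariant. Rather than passing to a limit, consider the
    matrices X such that |tr (X A)| <= c d for all these A, with c depending on
    X only. They form a linear subspace which contains every g B g^* - B,
    because tr ((g B g^* - B) A) = tr (B (A^g - A)). By Schur's lemma only scalar
    matrices are orthogonal to all g B g^* - B for the trace pairing, so
    the subspace contains every matrix of trace zero ([traceless_vanishing]).

    Apply this to X := P - p/n: the hull contains A with tr (P A) as close to
    pq/n as desired. If dim (W :&: gU) > pq/n held for every g, integrality
    would give tr (P Q^g) >= pq/n + 1/n on the orbit, hence on the whole hull: a
    contradiction ([exists_small_cap]). *)

Set Implicit Arguments.
Unset Strict Implicit.
Unset Printing Implicit Defensive.

Import Order.TTheory GRing.Theory Num.Theory.
Import passmx.

Local Open Scope classical_set_scope.
Local Open Scope ring_scope.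
Local Open Scope sesquilinear_scope.

(** * The Hilbert-Schmidt norm *)

Lemma mxtraceB (R : nzRingType) n (A B : 'M[R]_n) : \tr (A - B) = \tr A - \tr B.
Proof. exact: raddfB. Qed.

Section Adjoint.
Variable C : numClosedFieldType.

Lemma adjmx_mul m n p (A : 'M[C]_(m, n)) (B : 'M[C]_(n, p)) :
  (A *m B)^t* = B^t* *m A^t*.
Proof. by rewrite trmx_mul map_mxM. Qed.

Lemma adjmxB m n (A B : 'M[C]_(m, n)) : (A - B)^t* = A^t* - B^t*.
Proof. by rewrite linearB map_mxB. Qed.

End Adjoint.

Section HilbertSchmidt.
Variables (C : numClosedFieldType) (n : nat).
Implicit Types (A B X g : 'M[C]_n).

Definition hsnorm2 A : C := \sum_i \sum_j `|A i j| ^+ 2.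

Lemma hsnorm2E A : hsnorm2 A = \tr (A *m A^t*).
Proof.
apply: eq_bigr => i _; rewrite mxE; apply: eq_bigr => j _.
by rewrite !mxE -normCK.
Qed.

Lemma hsnorm2_ge0 A : 0 <= hsnorm2 A.
Proof. by do 2!apply: sumr_ge0 => ? _; rewrite exprn_ge0. Qed.

Lemma hsnorm2_ge_entry A i j : `|A i j| ^+ 2 <= hsnorm2 A.
Proof.
rewrite /hsnorm2 (bigD1 i)//= (bigD1 j)//= -addrA lerDl addr_ge0//.
  by apply: sumr_ge0 => ? _; rewrite exprn_ge0.
by do 2!apply: sumr_ge0 => ? _; rewrite exprn_ge0.
Qed.

Lemma hsnorm2Z a A : hsnorm2 (a *: A) = `|a| ^+ 2 * hsnorm2 A.
Proof.
rewrite /hsnorm2 mulr_sumr; apply: eq_bigr => i _; rewrite mulr_sumr.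
by apply: eq_bigr => j _; rewrite !mxE normrM exprMn.
Qed.

(** Unitary conjugation preserves the norm, so that A and A^g are nearly minimal
    together. *)
Lemma hsnorm2_conj g A : g \is unitarymx ->
  hsnorm2 (g^t* *m A *m g) = hsnorm2 A.
Proof.
move=> gU; rewrite !hsnorm2E !adjmx_mul trmxCK.
have -> : g^t* *m A *m g *m (g^t* *m (A^t* *m g)) =
  g^t* *m (A *m (g *m g^t*) *m A^t* *m g) by rewrite !mulmxA.
by rewrite mxtrace_mulC (unitarymxP gU) mulmx1 -!mulmxA (unitarymxP gU) mulmx1.
Qed.

Lemma hsnorm2_parallelogram A B :
  hsnorm2 (A + B) + hsnorm2 (A - B) = 2 * (hsnorm2 A + hsnorm2 B).
Proof.
rewrite /hsnorm2 -!big_split /= mulr_sumr; apply: eq_bigr => i _.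
rewrite -!big_split /= mulr_sumr; apply: eq_bigr => j _; rewrite !mxE.
rewrite !normCK !rmorphB !rmorphD /=.
by ring.
Qed.

End HilbertSchmidt.

(** * Double annihilators for the trace pairing *)

(** A subspace given by an arbitrary predicate is a [{vspace _}]: take one of
    maximal dimension inside it; adjoining any further vector of the predicate
    would raise the dimension. *)
Lemma vspace_of_linear_pred (F : fieldType) (vT : vectType F) (D : vT -> Prop) :
  D 0 -> (forall a u v, D u -> D v -> D (a *: u + v)) ->
  exists L : {vspace vT}, forall u, u \in L <-> D u.
Proof.
move=> D0 Dlin.
pose P k := `[< exists2 L : {vspace vT}, \dim L = k & forall u, u \in L -> D u >].
have P0 : exists k, P k.
  exists 0%N; apply/asboolP; exists 0%VS; first by rewrite dimv0.
  by move=> u /[!memv0] /eqP ->.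
have Pmax k : P k -> (k <= \dim {:vT})%N.
  by move=> /asboolP[L <- _]; rewrite dimvS ?subvf.
case: (ex_maxnP P0 Pmax) => k /asboolP[L dimL LD] kmax.
exists L => u; split; first exact: LD.
move=> Du; have PLu : P (\dim (L + <[u]>)).
  apply/asboolP; exists (L + <[u]>)%VS => // _ /memv_addP[v vL [_ /vlineP[a ->] ->]].
  by rewrite addrC; apply: Dlin => //; apply: LD.
have /eqP-> : L == (L + <[u]>)%VS.
  by rewrite eqEdim addvSl dimL kmax.
exact: (subvP (addvSr _ _)) (memv_line _).
Qed.

Section Trace.
Variables (C : numClosedFieldType) (n : nat).
Implicit Types (A B X g : 'M[C]_n).

Lemma norm_mxtrace_mul_le B (Y : 'M[C]_n) (d : C) : (forall i j, `|Y i j| <= d) ->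
  `|\tr (B *m Y)| <= (\sum_i \sum_j `|B i j|) * d.
Proof.
move=> Yd; rewrite mulr_suml; apply: le_trans (ler_norm_sum _ _ _) _.
apply: ler_sum => i _; rewrite mulr_suml mxE.
apply: le_trans (ler_norm_sum _ _ _) _.
by apply: ler_sum => j _; rewrite normrM ler_wpM2l.
Qed.

(** A linear functional is the trace pairing with the matrix of its values at the
    matrix units. *)
Lemma entry_lfun_trace (f : 'End('M[C]_n)) (k l : 'I_n) X :
  f X k l = \tr (X *m \matrix_(j, i) f (delta_mx i j) k l).
Proof.
rewrite {1}[X]matrix_sum_delta linear_sum summxE /= /mxtrace.
apply: eq_bigr => i _; rewrite linear_sum summxE mxE; apply: eq_bigr => j _.
by rewrite linearZ /= !mxE.
Qed.

(** The projection along L onto a complement kills L but not X0; one of its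
    entries is the separating functional. *)
Lemma trace_separation (L : {vspace 'M[C]_n}) X0 : X0 \notin L ->
  exists2 B, forall X, X \in L -> \tr (X *m B) = 0 & \tr (X0 *m B) != 0.
Proof.
move=> X0L; pose f : 'End('M[C]_n) := (\1 - projv L)%VF.
have fE X : f X = X - projv L X by rewrite !lfunE /= !lfunE.
have /matrix0Pn[k [l fkl]] : f X0 != 0.
  by apply: contra X0L; rewrite fE subr_eq0 => /eqP->; apply: memv_proj.
exists (\matrix_(j, i) f (delta_mx i j) k l) => [X XL|];
  rewrite -entry_lfun_trace//.
by rewrite fE projv_id// subrr mxE.
Qed.

(** A subspace of matrices is its own double annihilator. This puts X0 in the
    subspace without expressing it through generators. *)
Lemma linear_pred_trace_closed (D : 'M[C]_n -> Prop) X0 :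
  D 0 -> (forall a X Y, D X -> D Y -> D (a *: X + Y)) ->
  (forall B, (forall X, D X -> \tr (X *m B) = 0) -> \tr (X0 *m B) = 0) ->
  D X0.
Proof.
move=> D0 Dlin annD; have [L LD] := vspace_of_linear_pred D0 Dlin.
apply/LD; apply: contraPT annD => /trace_separation[B BL X0B] /(_ B) annB.
by case/eqP: X0B; apply: annB => X /LD/BL.
Qed.

End Trace.

(** * Invariant scalars and nearly invariant matrices *)

Section Schur.
Variables (C : numClosedFieldType) (n : nat) (T : 'M[C]_n -> Prop).
Hypothesis n_gt0 : (0 < n)%N.
Hypothesis Tirr : forall M : 'M[C]_n,
  (forall g, T g -> (M *m g <= M)%MS) -> M != 0 -> (1%:M <= M)%MS.

(** Schur's lemma: an eigenspace of B is invariant, hence everything. *)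
Lemma schur_scalar B : (forall g, T g -> B *m g = g *m B) ->
  exists b, B = b%:M.
Proof.
move=> Bcomm; have [b] := eigenvalue_closed B n_gt0; rewrite /eigenvalue => Bb.
exists b; have /eigenspaceP : (1%:M <= eigenspace B b)%MS.
  apply: Tirr => // g Tg; apply: comm_mx_stable_eigenspace; exact: Bcomm.
by rewrite mul1mx scalemx1.
Qed.

End Schur.

Section Hull.
Variables (C : numClosedFieldType) (n : nat) (T : 'M[C]_n -> Prop) (Q : 'M[C]_n).
Hypothesis Tunitary : forall g, T g -> g \is unitarymx.
Hypothesis Tmul : forall g h, T g -> T h -> T (g *m h).

(** A substitute for the convex hull of the orbit of Q: closure under midpoints is
    all that the parallelogram law needs, and it avoids weights. *)
Inductive midhull : 'M[C]_n -> Prop :=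
| midhull_orbit g : T g -> midhull (g^t* *m Q *m g)
| midhull_mid A B : midhull A -> midhull B -> midhull (2^-1 *: (A + B)).

Lemma midhull_conj g A : T g -> midhull A -> midhull (g^t* *m A *m g).
Proof.
move=> Tg; elim=> [h Th|A1 A2 _ IH1 _ IH2].
  have -> : g^t* *m (h^t* *m Q *m h) *m g = (h *m g)^t* *m Q *m (h *m g).
    by rewrite adjmx_mul !mulmxA.
  exact/midhull_orbit/Tmul.
by rewrite -scalemxAr -scalemxAl mulmxDr mulmxDl; apply: midhull_mid.
Qed.

Lemma midhull_trace A : midhull A -> \tr A = \tr Q.
Proof.
elim=> [g Tg|A1 A2 _ IH1 _ IH2].
  by rewrite -mulmxA mxtrace_mulC -mulmxA (unitarymxP (Tunitary Tg)) mulmx1.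
by rewrite mxtraceZ mxtraceD IH1 IH2; field.
Qed.

Lemma midhull_trace_ge P c : (forall g, T g -> c <= \tr (P *m (g^t* *m Q *m g))) ->
  forall A, midhull A -> c <= \tr (P *m A).
Proof.
move=> cP A; elim=> [g Tg|A1 A2 _ IH1 _ IH2]; first exact: cP.
rewrite -scalemxAr mxtraceZ mulmxDr mxtraceD.
have -> : c = 2^-1 * (c + c) by field.
by rewrite ler_pM2l ?invr_gt0 ?ltr0n// lerD.
Qed.

(** This is the approximate form of the uniqueness of the point of least norm: by the
    parallelogram law, |A - B|^2 = 2|A|^2 + 2|B|^2 - 4|(A + B)/2|^2, where the
    midpoint cannot go below the infimum m. *)
Lemma near_minimal_close (A B : 'M[C]_n) (m d : C) : 0 <= d ->
  m <= hsnorm2 (2^-1 *: (A + B)) ->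
  hsnorm2 A <= m + d ^+ 2 -> hsnorm2 B <= m + d ^+ 2 ->
  forall i j, `|(A - B) i j| <= 2 * d.
Proof.
move=> d0 mAB Am Bm i j.
rewrite -(ler_pXn2r (ltn0Sn 1)) ?nnegrE ?mulr_ge0//.
apply: le_trans (hsnorm2_ge_entry _ _ _) _.
have -> : hsnorm2 (A - B) =
    2 * (hsnorm2 A + hsnorm2 B) - 4 * hsnorm2 (2^-1 *: (A + B)).
  rewrite hsnorm2Z -hsnorm2_parallelogram normrV ?unitfE ?pnatr_eq0// normr_nat.
  by field.
have -> : (2 * d) ^+ 2 = 2 * ((m + d ^+ 2) + (m + d ^+ 2)) - 4 * m by ring.
by rewrite lerB// ler_pM2l ?ltr0n// lerD.
Qed.

Section NearMinimal.
Variable m : C.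
Implicit Types (A B X Y g : 'M[C]_n) (a c d : C).
Hypothesis m_le : forall A, midhull A -> m <= hsnorm2 A.

(** When A converges to the point of least norm, d tends to 0 and so does
    tr (X A). The linear rate makes the property stable under linear
    combinations without any choice of a common d. *)
Definition vanishes_near_min X := exists2 c : C, 0 <= c &
  forall d A, 0 <= d -> midhull A -> hsnorm2 A <= m + d ^+ 2 ->
    `|\tr (X *m A)| <= c * d.

Lemma vanishing0 : vanishes_near_min 0.
Proof. by exists 0 => // d A _ _ _; rewrite mul0mx mxtrace0 normr0 mul0r. Qed.

Lemma vanishing_linear a X Y :
  vanishes_near_min X -> vanishes_near_min Y -> vanishes_near_min (a *: X + Y).
Proof.
move=> [c c0 Xc] [e e0 Ye]; exists (`|a| * c + e) => [|d A d0 SA Am].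
  by rewrite addr_ge0// mulr_ge0.
rewrite mulmxDl -scalemxAl mxtraceD mxtraceZ mulrDl.
apply: le_trans (ler_normD _ _) _; rewrite lerD ?Ye// normrM -mulrA ler_wpM2l//.
exact: Xc.
Qed.

(** Moving the conjugation to A turns the trace into tr (B (A^g - A)), which is
    small since a nearly minimal A is nearly invariant. *)
Lemma vanishing_commutator g B : T g -> vanishes_near_min (g *m B *m g^t* - B).
Proof.
move=> Tg; exists ((\sum_i \sum_j `|B i j|) * 2) => [|d A d0 SA Am].
  by rewrite mulr_ge0//; do 2!apply: sumr_ge0 => ? _.
have -> : \tr ((g *m B *m g^t* - B) *m A) = \tr (B *m (g^t* *m A *m g - A)).
  rewrite mulmxBl mulmxBr !mxtraceB; congr (_ - _).
  by rewrite -!mulmxA mxtrace_mulC !mulmxA.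
rewrite -mulrA; apply: norm_mxtrace_mul_le.
have SgA := midhull_conj Tg SA.
apply: (near_minimal_close d0 (m_le (midhull_mid SgA SA)) _ Am).
by rewrite hsnorm2_conj//; apply: Tunitary.
Qed.

Hypothesis n_gt0 : (0 < n)%N.
Hypothesis Tirr : forall M : 'M[C]_n,
  (forall g, T g -> (M *m g <= M)%MS) -> M != 0 -> (1%:M <= M)%MS.

(** A matrix B orthogonal to all differences g X g^* - X commutes with every g,
    hence is scalar and orthogonal to every traceless matrix; conclude by
    taking the double annihilator. *)
Lemma traceless_vanishing X : \tr X = 0 -> vanishes_near_min X.
Proof.
move=> trX; apply: linear_pred_trace_closed vanishing0 vanishing_linear _ => B annB.
suff [b ->] : exists b, B = b%:M by rewrite mul_mx_scalar mxtraceZ trX mulr0.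
apply: (schur_scalar n_gt0 Tirr) => g Tg.
have gU := Tunitary Tg.
(* Testing orthogonality on the difference built from the adjoint of Y yields
   the squared norm of Y. *)
pose Y := g^t* *m B *m g - B.
have Y0 : hsnorm2 Y = 0.
  rewrite hsnorm2E mxtrace_mulC.
  rewrite -[RHS](annB _ (vanishing_commutator (Y^t* ) Tg)).
  rewrite mulmxBl {2}/Y mulmxBr !mxtraceB; congr (_ - _).
  by rewrite -!mulmxA [RHS]mxtrace_mulC !mulmxA.
have /subr0_eq {2}<- : Y = 0.
  apply/matrixP => i j; rewrite [RHS]mxE; apply/eqP.
  rewrite -normr_eq0 -sqrf_eq0 eq_le exprn_ge0// andbT -Y0.
  exact: hsnorm2_ge_entry.
by rewrite !mulmxA (unitarymxP gU) mul1mx.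
Qed.

End NearMinimal.
End Hull.

(** * Traces of products of orthogonal projections *)

Section Projections.
Variables (C : numClosedFieldType) (n : nat).
Implicit Types (A B P Q E X g : 'M[C]_n).

Definition is_oproj P := P^t* = P /\ P *m P = P.

(** If the rows of S are an orthonormal basis of the row space of A, the projection
    is S^* S, whose trace is that of S S^* = 1. *)
Lemma exists_oproj A : exists P, [/\ is_oproj P, (P :=: A)%MS & \tr P = (\rank A)%:R].
Proof.
pose S := schmidt (row_base A).
have SU : S \is unitarymx by rewrite schmidt_unitarymx// rank_leq_col.
have SA : (S :=: A)%MS.
  exact: eqmx_trans (eqmx_schmidt_free (row_base_free A)) (eq_row_base A).
exists (S^t* *m S); split.
- split; first by rewrite adjmx_mul trmxCK.
  by rewrite -mulmxA [S *m _]mulmxA (unitarymxP SU) mul1mx.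
- apply: eqmx_trans SA; apply/eqmxP; rewrite submxMl /=.
  by rewrite -{1}[S]mul1mx -(unitarymxP SU) -mulmxA submxMl.
- by rewrite mxtrace_mulC (unitarymxP SU) mxtrace1.
Qed.

Lemma oproj_sub P m (U : 'M[C]_(m, n)) : is_oproj P -> (U <= P)%MS -> U *m P = U.
Proof. by move=> [_ PP] /submxP[v ->]; rewrite -mulmxA PP. Qed.

Lemma oproj_conj g P : g \is unitarymx -> is_oproj P -> is_oproj (g^t* *m P *m g).
Proof.
move=> gU [Pa PP]; split; first by rewrite !adjmx_mul trmxCK Pa mulmxA.
have -> : g^t* *m P *m g *m (g^t* *m P *m g) =
  g^t* *m (P *m (g *m g^t*) *m P) *m g by rewrite !mulmxA.
by rewrite (unitarymxP gU) mulmx1 PP.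
Qed.

Lemma oproj_sub2 E P : is_oproj E -> is_oproj P -> (E <= P)%MS ->
  E *m P = E /\ P *m E = E.
Proof.
move=> Eo Po EP; have EPE := oproj_sub Po EP; split=> //.
by case: Eo Po => [Ea _] [Pa _]; rewrite -{1}Pa -{1}Ea -adjmx_mul EPE.
Qed.

Lemma oproj_diff E P : is_oproj E -> is_oproj P -> (E <= P)%MS -> is_oproj (P - E).
Proof.
move=> Eo Po EP; have [EPE PEE] := oproj_sub2 Eo Po EP.
case: Eo Po => [Ea EE] [Pa PP]; split; first by rewrite adjmxB Ea Pa.
by rewrite mulmxBl !mulmxBr PP PEE EPE EE subrr subr0.
Qed.

(** Idempotence and cyclicity turn the trace into the squared norm of PQ. *)
Lemma oproj_trace_ge0 P Q : is_oproj P -> is_oproj Q -> 0 <= \tr (P *m Q).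
Proof.
move=> [Pa PP] [Qa QQ].
have -> : \tr (P *m Q) = hsnorm2 (P *m Q).
  rewrite hsnorm2E adjmx_mul Pa Qa.
  have -> : P *m Q *m (Q *m P) = P *m (Q *m Q) *m P by rewrite !mulmxA.
  by rewrite QQ [RHS]mxtrace_mulC mulmxA PP.
exact: hsnorm2_ge0.
Qed.

(** With E the projection on the intersection,
    tr (PQ) = tr E + tr ((P - E)(Q - E)), and P - E and Q - E are again orthogonal
    projections. *)
Lemma rank_cap_le_trace P Q : is_oproj P -> is_oproj Q ->
  (\rank (P :&: Q)%MS)%:R <= \tr (P *m Q).
Proof.
move=> Po Qo; have [E [Eo EPQ <-]] := exists_oproj (P :&: Q)%MS.
have EP : (E <= P)%MS by rewrite EPQ capmxSl.
have EQ : (E <= Q)%MS by rewrite EPQ capmxSr.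
have := oproj_trace_ge0 (oproj_diff Eo Po EP) (oproj_diff Eo Qo EQ).
have [_ PE] := oproj_sub2 Eo Po EP; have [EQE _] := oproj_sub2 Eo Qo EQ.
have [_ EE] := Eo.
by rewrite mulmxBl !mulmxBr PE EQE EE subrr subr0 mxtraceB subr_ge0.
Qed.

End Projections.

(** * Small intersections for a unitary matrix group *)

(** Completeness, in a form suited to the partial order of a complex field: being a
    greatest lower bound is replaced by approximation from above. *)
Definition nonneg_infima (C : numDomainType) := forall S : C -> Prop,
  (exists x, S x) -> (forall x, S x -> 0 <= x) ->
  exists m : C, (forall x, S x -> m <= x) /\
    (forall e, 0 < e -> exists2 x, S x & x <= m + e).

(** The hull contains matrices A whose trace against P is arbitrarily close to
    rank W * rank U / n, whereas it would stay at distance 1/n if all the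
    intersections were too large. *)
Lemma exists_small_cap (C : numClosedFieldType) (n : nat) (T : 'M[C]_n -> Prop)
    (C_inf : nonneg_infima C)
    (n_gt0 : (0 < n)%N)
    (Tunitary : forall g, T g -> g \is unitarymx)
    (T1 : T 1%:M)
    (Tmul : forall g h, T g -> T h -> T (g *m h))
    (Tirr : forall M : 'M[C]_n,
      (forall g, T g -> (M *m g <= M)%MS) -> M != 0 -> (1%:M <= M)%MS)
    (U W : 'M[C]_n) :
  exists2 g, T g & (n * \rank (W :&: U *m g)%MS <= \rank W * \rank U)%N.
Proof.
have [Q [Qo QU trQ]] := exists_oproj U.
have [P [Po PW trP]] := exists_oproj W.
have n0 : n%:R != 0 :> C by rewrite pnatr_eq0 -lt0n.
apply: contrapT => noT.
pose c : C := (\rank W * \rank U)%:R / n%:R.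
have big g : T g -> c + n%:R^-1 <= \tr (P *m (g^t* *m Q *m g)).
  move=> Tg; have gU := Tunitary _ Tg.
  have gtu : g^t* \in unitmx by rewrite unitarymx_unit// trmxC_unitary.
  apply: le_trans (rank_cap_le_trace Po (oproj_conj gU Qo)).
  have -> : \rank (P :&: g^t* *m Q *m g)%MS = \rank (W :&: U *m g)%MS.
    apply/eqmx_rank/eqmxP/cap_eqmx => //.
    rewrite -mulmxA; apply: eqmx_trans (eqmxMfull _ _) (eqmxMr _ QU).
    by rewrite row_full_unit.
  rewrite /c -[X in _ + X]mul1r -mulrDl ler_pdivrMr ?ltr0n// natr1 -natrM ler_nat.
  rewrite [(_ * n)%N]mulnC ltnNge; apply/negP => le_cap; apply: noT.
  by exists g.
have [||m [m_lb m_near]] :=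
    C_inf (fun x => exists2 A, midhull T Q A & x = hsnorm2 A).
- pose A0 := 1%:M^t* *m Q *m 1%:M.
  by exists (hsnorm2 A0), A0 => //; apply: midhull_orbit.
- by move=> _ [A _ ->]; apply: hsnorm2_ge0.
have m_le A : midhull T Q A -> m <= hsnorm2 A by move=> SA; apply: m_lb; exists A.
pose X := P - (\tr P / n%:R)%:M.
have trX : \tr X = 0.
  by rewrite mxtraceB mxtrace_scalar -(mulr_natr (\tr P / n%:R)) divfK// subrr.
have [k k0 kX] := traceless_vanishing Tunitary Tmul m_le n_gt0 Tirr trX.
(* This d makes the error k d smaller than 1/n, the gap that integrality
   leaves. *)
pose d : C := (n%:R * (k + 1))^-1.
have k1 : 0 < k + 1 by rewrite ltr_wpDl.
have d0 : 0 < d by rewrite invr_gt0 mulr_gt0// ltr0n.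
have [_ [A SA ->] Am] := m_near _ (exprn_gt0 2 d0).
have trXA : \tr (X *m A) = \tr (P *m A) - c.
  rewrite mulmxBl mxtraceB mul_scalar_mx mxtraceZ (midhull_trace Tunitary SA).
  by rewrite trP trQ /c natrM mulrAC.
have trXA_ge : n%:R^-1 <= \tr (X *m A).
  by rewrite trXA lerBrDl; apply: midhull_trace_ge SA.
have lt_kd : k * d < n%:R^-1.
  rewrite /d invfM mulrCA gtr_pMr ?invr_gt0 ?ltr0n//.
  by rewrite ltr_pdivrMr// mul1r ltrDl.
have := kX d A (ltW d0) SA Am.
have n1 : 0 <= n%:R^-1 :> C by rewrite invr_ge0 ler0n.
by rewrite ger0_norm ?(le_trans n1)// (lt_geF (lt_le_trans lt_kd trXA_ge)).
Qed.

(** * Orthonormal coordinates *)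

Section OrthonormalBasis.
Variables (C : numClosedFieldType) (V : vectType C) (form : {dot V for Num.conj}).

(** Normalize a vector of X and recurse in its orthogonal complement in X. *)
Lemma exists_orthonormal_span (X : {vspace V}) :
  exists2 s : seq V, orthonormal form s & << s >>%VS = X.
Proof.
move: {2}(\dim X) (leqnn (\dim X)) => k.
elim: k X => [|k IH] X dimX.
  exists [::] => //; rewrite span_nil; apply/esym/eqP.
  by rewrite -dimv_eq0 -leqn0.
have [X0|X0] := eqVneq X 0%VS; first by exists [::]; rewrite ?span_nil.
pose v := vpick X; have v0 : v != 0 by rewrite vpick0.
pose u := (sqrtC (form v v))^-1 *: v.
have fv : 0 < form v v by rewrite dnorm_gt0.
have uX : u \in X by rewrite memvZ ?memv_pick.
have uu : form u u = 1.
  rewrite dnormZ normrV ?unitfE ?sqrtC_eq0 ?gt_eqF// ger0_norm ?sqrtC_ge0 ?ltW//.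
  by rewrite exprVn sqrtCK mulVf ?gt_eqF.
have u_northo : u \notin orthov form X.
  apply/mem_orthovPn; exists u => //; apply/eqP => uu0.
  by move: (oner_neq0 C); rewrite -uu uu0 eqxx.
have [s os spans] : exists2 s : seq V, orthonormal form s &
    << s >>%VS = (X :&: orthov form <[u]>)%VS.
  apply: IH; rewrite -eq_dim_orthov1//; by case: (\dim X) dimX.
have su x : x \in s -> form x u = 0.
  move=> xs; have : x \in << s >>%VS by apply: memv_span.
  by rewrite spans memv_cap mem_orthov1 => /andP[_ /eqP].
exists (u :: s).
  move: os => /andP[s1 ss]; apply/andP; split; first by rewrite /= uu eqxx.
  apply/andP; split=> //; rewrite /ortho_rec /= andbT.
  by apply/allP => x xs /=; rewrite herm_eq0C; apply/eqP; apply: su.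
apply/eqP; rewrite span_cons spans -(geq_leqif (dimv_leqif_eq _)).
  rewrite dimv_disjoint_sum.
    rewrite dim_vline -eq_dim_orthov1//.
    have -> : u != 0 by rewrite -(dnorm_gt0 form) uu; apply: ltr01.
    by rewrite add1n leqSpred.
  apply/eqP; rewrite -subv0; apply/subvP => x.
  rewrite !memv_cap => /andP[/vlineP[a ->]] /andP[_].
  rewrite mem_orthov1 linearZl_LR /= uu mulr1 => /eqP ->.
  by rewrite scale0r mem0v.
by rewrite subv_add -memvE uX capvSl.
Qed.

Lemma exists_orthonormal_basis :
  exists2 e : (\dim {:V}).-tuple V, basis_of {:V} e &
    forall i j : 'I_(\dim {:V}), form e`_i e`_j = (i == j)%:R.
Proof.
have [s os spans] := exists_orthonormal_span {:V}.
have sb : basis_of {:V} s by rewrite /basis_of spans eqxx (orthonormal_free os).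
have ss : size s == \dim {:V}.
  by rewrite -spans eq_sym; apply: (orthonormal_free os).
exists (Tuple ss) => // i j.
have /orthonormalP[us /= ->] := os; rewrite ?mem_nth ?(eqP ss)//.
by rewrite nth_uniq ?(eqP ss).
Qed.

Section Coordinates.
Variable e : (\dim {:V}).-tuple V.
Hypothesis e_basis : basis_of {:V} e.
Hypothesis e_ortho : forall i j : 'I_(\dim {:V}), form e`_i e`_j = (i == j)%:R.

Lemma dotmx_rVof u v : dotmx (rVof e u) (rVof e v) = form u v.
Proof.
rewrite -{2}(rVofK e_basis u) -{2}(rVofK e_basis v) /vecof linear_sumlz dotmxE.
rewrite mxE; apply: eq_bigr => i _; rewrite linear_sumr (bigD1 i)//= big1.
  by rewrite addr0 linearZl_LR linearZr_LR /= e_ortho eqxx mulr1 !mxE.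
move=> j ji; rewrite linearZl_LR linearZr_LR /= e_ortho eq_sym (negPf ji).
by rewrite !mulr0.
Qed.

Lemma mxof_isometry_unitary (f : 'End(V)) :
  isometry form form f -> mxof e e f \is unitarymx.
Proof.
move=> isof; apply/row_unitarymxP => i j.
rewrite !rowE !mul_mxof dotmx_rVof isof !vecof_delta; exact: e_ortho.
Qed.

End Coordinates.
End OrthonormalBasis.

Section Dimension.
Variables (F : fieldType) (V : vectType F) (e : (\dim {:V}).-tuple V).
Hypothesis e_basis : basis_of {:V} e.

(** The coordinates of a basis of U form a row-free matrix with the same row space as
    [msof e U]. *)
Lemma rank_msof (U : {vspace V}) : \rank (msof e U) = \dim U.
Proof.
pose X := \matrix_(i < \dim U) rVof e (vbasis U)`_i.
have mulX k : k *m X = rVof e (\sum_i k 0 i *: (vbasis U)`_i).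
  rewrite linear_sum mulmx_sum_row; apply: eq_bigr => i _.
  by rewrite rowK linearZ.
have Xfree : row_free X.
  apply: inj_row_free => k; rewrite mulX => /eqP; rewrite rVof_eq0// => /eqP k0.
  have /freeP fU := basis_free (vbasisP U).
  by apply/rowP => i; rewrite mxE; apply: fU.
rewrite -[RHS](eqP Xfree); apply/eqmx_rank/andP; split.
  apply/rV_subP => u; rewrite -mem_vecof// => /coord_vbasis vu.
  apply/submxP; exists (\row_i coord (vbasis U) i (vecof e u)).
  rewrite mulX -[u in LHS](vecofK e_basis) {1}vu; congr (rVof e _).
  by apply: eq_bigr => i _; rewrite mxE.
apply/row_subP => i; rewrite rowK -mem_vecof// rVofK//.
by rewrite vbasis_mem// mem_nth// size_tuple.
Qed.

Lemma msof_limg (f : 'End(V)) (U : {vspace V}) :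
  (msof e (f @: U) :=: msof e U *m mxof e e f)%MS.
Proof.
apply/eqmxP/rV_eqP => u; rewrite -mem_vecof//; apply/idP/idP.
  move=> /memv_imgP[v vU ufv]; rewrite -[u](vecofK e_basis) ufv (rVof_app e e_basis).
  by rewrite submxMr// -mem_vecof// rVofK.
move=> /submxP[w ->]; rewrite mulmxA -hom_vecof// memv_img//.
by rewrite mem_vecof// submxMl.
Qed.

Lemma msof_cap (U W : {vspace V}) :
  (msof e (U :&: W) :=: msof e U :&: msof e W)%MS.
Proof.
apply/eqmxP/rV_eqP => u.
by rewrite sub_capmx -!mem_vecof// memv_cap.
Qed.

Lemma dim_cap_limg (f : 'End(V)) (U W : {vspace V}) :
  \dim (W :&: f @: U) = \rank (msof e W :&: msof e U *m mxof e e f)%MS.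
Proof.
rewrite -[LHS]rank_msof; apply/eqmx_rank/eqmxP.
exact: eqmx_trans (msof_cap _ _) (cap_eqmx (eqmx_refl _) (msof_limg _ _)).
Qed.

Lemma dim_limg_unit (f : 'End(V)) (U : {vspace V}) :
  mxof e e f \in unitmx -> \dim (f @: U) = \dim U.
Proof.
move=> fU; rewrite -[LHS]rank_msof -[RHS]rank_msof.
by rewrite (eqmx_rank (introT eqmxP (msof_limg f U))) mxrankMfree ?row_free_unit.
Qed.

End Dimension.

(** * Irreducible unitary representations *)

(** The coordinate-free form of [exists_small_cap]. A set T of operators stands for
    the image of the group, and its elements become unitary matrices in an orthonormal
    basis. *)
Lemma exists_isometry_small_cap (C : numClosedFieldType)
    (C_inf : nonneg_infima C) (V : vectType C) (form : {dot V for Num.conj})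
    (T : 'End(V) -> Prop) (V_neq0 : {:V}%VS <> 0%VS)
    (T_isometry : forall f, T f -> isometry form form f)
    (T1 : T \1%VF) (T_comp : forall f h, T f -> T h -> T (f \o h)%VF)
    (T_irreducible : forall X : {vspace V},
      (forall f, T f -> (f @: X <= X)%VS) -> X = 0%VS \/ X = {:V}%VS)
    (U W : {vspace V}) :
  exists2 f, T f &
    \dim (f @: U) = \dim U /\
    (\dim {:V} * \dim (W :&: f @: U) <= \dim W * \dim U)%N.
Proof.
have [e eb eo] := exists_orthonormal_basis form.
have n_gt0 : (0 < \dim {:V})%N by rewrite lt0n dimv_eq0; apply/eqP.
pose G M := exists2 f, T f & M = mxof e e f.
have G_unitary M : G M -> M \is unitarymx.
  by move=> [f /T_isometry Tf ->]; apply: mxof_isometry_unitary eb eo _ Tf.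
have G1 : G 1%:M by exists \1%VF; rewrite // mxof1// (basis_free eb).
have G_mul M N : G M -> G N -> G (M *m N).
  move=> [f Tf ->] [h Th ->]; exists (h \o f)%VF; first exact: T_comp.
  by rewrite (mxof_comp e e eb).
have G_irr (M : 'M[C]_(\dim {:V})) :
    (forall g, G g -> (M *m g <= M)%MS) -> M != 0 -> (1%:M <= M)%MS.
  move=> Mst M0; have [f Tf||vM] := T_irreducible (vsof e M).
  - rewrite -(sub_msof eb) (msof_limg eb) (eqmxP (vsofK eb M)).
    by rewrite (eqmxMr _ (eqmxP (vsofK eb M))); apply: Mst; exists f.
  - by move/eqP; rewrite vsof_eq0// (negPf M0).
  - by rewrite -(sub_vsof eb) vM subvf.
have [_ [f Tf ->] cap_le] := exists_small_cap C_inf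
  n_gt0 G_unitary G1 G_mul G_irr (msof e U) (msof e W).
exists f => //; split.
  by apply: (dim_limg_unit eb); apply/unitarymx_unit/G_unitary; exists f.
by rewrite (dim_cap_limg eb) -(rank_msof eb W) -(rank_msof eb U).
Qed.

(** Nonnegative complex numbers are real, so the infimum is that of the real parts. *)
Lemma complex_nonneg_infima (R : realType) : nonneg_infima R[i].
Proof.
move=> S [x0 Sx0] S0; pose E := [set complex.Re x | x in [set x | S x]].
have SRe x : S x -> x = (complex.Re x)%:C%C.
  by move=> /S0 x_ge0; rewrite RRe_real// ger0_real.
have E0 : E !=set0 by exists (complex.Re x0), x0.
have Elb : has_lbound E.
  by exists 0 => _ [x Sx <-]; rewrite -ler0c -SRe// S0.
exists (inf E)%:C%C; split=> [x Sx|e e0].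
  by rewrite (SRe x Sx) lecR; apply: ge_inf => //; exists x.
have eRe : e = (complex.Re e)%:C%C by rewrite RRe_real// gtr0_real.
have : 0 < complex.Re e by rewrite -ltcR -eRe.
case/inf_adherent/(_ (conj E0 Elb)) => _ [x Sx <-] /ltW lt_e; exists x => //.
by rewrite (SRe x Sx) eRe -rmorphD lecR.
Qed.

Lemma codim_bound_of_cap (R : realFieldType) (n w u d k : nat) :
  (0 < n)%N -> (d + k = w + u)%N -> (n * k <= w * u)%N ->
  w%:R + (1 - w%:R / n%:R) * u%:R <= d%:R :> R.
Proof.
move=> n_gt0 dk nk.
have -> : d%:R = w%:R + u%:R - k%:R :> R by rewrite -natrD -dk natrD addrK.
rewrite mulrBl mul1r -addrA lerD2l lerD2l lerN2 mulrAC ler_pdivlMr ?ltr0n//.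
by rewrite -!natrM ler_nat mulnC.
Qed.

Local Close Scope sesquilinear_scope.

Theorem theorem1 (R : realType) (K : topologicalGroupType)
    (V : vectType R[i]) (form : {dot V for Num.conj}) (rho : K -> 'End(V))
    (K_compact : compact [set: K])
    (rho_rep : is_rep rho)
    (rho_continuous : continuous_rep rho)
    (rho_unitary : unitary_rep form rho)
    (rho_irreducible : irreducible_rep rho)
    (U W : {vspace V}) :
  exists g : K,
    (\dim (W + rho g @: U))%:R >=
      (\dim W)%:R + (1 - (\dim W)%:R / (\dim {:V})%:R) * (\dim U)%:R :> R.
Proof.
have [rho1 rhoM] := rho_rep; have [V_neq0 rho_irr] := rho_irreducible.
pose T f := exists g, f = rho g.
have T_isometry f : T f -> isometry form form f by move=> [g ->]; exact: rho_unitary.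
have T1 : T \1%VF by exists 1%g.
have T_comp f h : T f -> T h -> T (f \o h)%VF.
  by move=> [g1 ->] [g2 ->]; exists (g1 * g2)%g; rewrite rhoM.
have T_irr (X : {vspace V}) : (forall f, T f -> (f @: X <= X)%VS) ->
    X = 0%VS \/ X = {:V}%VS.
  by move=> TX; apply: rho_irr => g; apply: TX; exists g.
have [_ [g ->] [dim_gU cap_le]] := exists_isometry_small_cap
  (@complex_nonneg_infima R) V_neq0 T_isometry T1 T_comp T_irr U W.
exists g; apply: codim_bound_of_cap cap_le.
  by rewrite lt0n dimv_eq0; apply/eqP.
by rewrite dimv_sum_cap dim_gU.
Qed.
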